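(* For integers $b\ge2$ and $n\ge1$, the number of juggling card sequences $A$ with $b$ balls, using $n$ cards from $\{C_1,\dots,C_b\}$ at least one of which is $C_b$, having $\pi_A=\mathrm{id}$ and $Cr(A)=b(b-1)+2$, is \[ g(b,n)=\binom{n}{b+2}\binom{n}{b-2}. \]
   Context: There are $b$ balls on levels $1,\dots,b$. For $1\le i\le b$ the card $C_i$ induces the permutation $\pi_{C_i}$ of $[b]$ with $\pi_{C_i}(1)=i$, $\pi_{C_i}(j)=j-1$ for $2\le j\le i$, $\pi_{C_i}(j)=j$ for $j>i$. For a juggling card sequence $A=C_{i_1}\cdots C_{i_n}$, $\pi_A=\pi_{C_{i_n}}\circ\cdots\circ\pi_{C_{i_1}}$ (the ball starting at level $j$ ends at level $\pi_A(j)$), and the number of crossings is $Cr(A)=\sum_{k=1}^n(i_k-1)$. *)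

(* Defs.v *)
From mathcomp Require Import all_boot all_fingroup zify.

Set Implicit Arguments.
Unset Strict Implicit.
Unset Printing Implicit Defensive.

(* Levels 1..b and cards C_1..C_b are both indexed from 0: j : 'I_b is level
   j.+1, and i : 'I_b is the card C_(i.+1). *)

Fact card_fun_subproof b (j : 'I_b) : j.-1 < b.
Proof. exact: leq_ltn_trans (leq_pred j) (ltn_ord j). Qed.

Definition card_fun b (i j : 'I_b) : 'I_b :=
  if j == 0 :> nat then i
  else if j <= i then Ordinal (card_fun_subproof j)
  else j.

Fact card_fun_inj b (i : 'I_b) : injective (card_fun i).
Proof.
move=> j k /(congr1 val); rewrite /card_fun => e; apply: val_inj => /=.
move: e; case: i j k => i lt_ib [[|j] lt_jb] [[|k] lt_kb] //=.
- by case: leqP => /=; lia.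
- by case: leqP => /=; lia.
by case: leqP => /= ?; case: leqP => /=; lia.
Qed.

Definition card_perm b (i : 'I_b) : {perm 'I_b} := perm (@card_fun_inj b i).

(* In {perm _}, (s * t) x = t (s x), so the leftmost card acts first. *)
Definition pi_seq b n (A : n.-tuple 'I_b) : {perm 'I_b} :=
  (\prod_(k < n) card_perm (tnth A k))%g.

(* C_(i.+1) has i crossings because of the shift of indices. *)
Definition crossings b n (A : n.-tuple 'I_b) : nat :=
  \sum_(k < n) (tnth A k : nat).

Definition uses_top_card b n (A : n.-tuple 'I_b) : bool :=
  [exists k, (tnth A k).+1 == b].

(* Main.v *)
Require Import Defs.
From mathcomp Require Import all_boot all_fingroup.
From mathcomp Require Import zify.

(** Record the ball thrown at each time: up to renaming the balls, card sequences
    with trivial permutation that use the top card are the cyclic words of length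
    [n] in which every ball occurs. The number of crossings is the sum, over ordered
    pairs [(a, c)] of distinct balls, of the number of cyclic switches from [a]
    to [c]. Each summand is
    positive and symmetric in [a] and [c], so [b (b - 1) + 2] crossings means that
    exactly one pair [{x, y}] switches twice in each direction and all other pairs
    once: merging [x] and [y] gives a noncrossing partition.

    Rotate the word so that it ends with a switch from [x] to [y]. Such words are
    the ones read by a pushdown automaton with initial stack [y x y x]: each letter
    is the top of the stack, possibly pushed just before (a new ball) and possibly
    popped just after (its last occurrence, or the end of a run of [x] or [y]).
    Recording pushes and pops gives first-passage walks from 4 to 0 with [b - 2]
    pushes, counted by [(4/n) C(n, b - 2) C(n, b + 2)]. Every word has four
    possible switches to rotate to, which cancels the factor [4/n]. *)

Set Implicit Arguments.
Unset Strict Implicit.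
Unset Printing Implicit Defensive.

(** * Words read by a pushdown automaton *)

Section Destutter.

Variable T : eqType.
Implicit Types (a c : T) (s v w : seq T).

Definition cons_new a s := if ohead s == Some a then s else a :: s.

Definition destutter s := foldr cons_new [::] s.

Lemma ohead_cons_new a s : ohead (cons_new a s) = Some a.
Proof. by rewrite /cons_new; case: eqP. Qed.

Lemma ohead_destutter s : ohead (destutter s) = ohead s.
Proof. by case: s => //= a s; rewrite ohead_cons_new. Qed.

Lemma destutter_subseq s : subseq (destutter s) s.
Proof.
elim: s => //= a s IH; rewrite /cons_new; case: ifP => _ /=; last by rewrite eqxx.
exact: subseq_trans IH (subseq_cons _ _).
Qed.

Lemma mem_destutter s : destutter s =i s.
Proof.
elim: s => //= a s IH c; rewrite inE -IH /cons_new; case: ifP => [/eqP|_] //=.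
case: (destutter s) => //= b r [->]; rewrite !inE.
by case: (c == a).
Qed.

Lemma last_destutter c s : last c (destutter s) = last c s.
Proof.
elim: s c => //= a s IH c; rewrite -IH /cons_new; case: ifP => //.
by case: (destutter s).
Qed.

(** No other letter precedes an occurrence of [a], so these occurrences form an initial block, which
    collapses to one letter. *)
Lemma destutter_leading a v :
  a \in v -> (forall c, c != a -> ~~ subseq [:: c; a] v) ->
  destutter v = a :: destutter (filter (predC1 a) v).
Proof.
elim: v => // d v IH; rewrite inE => av nca.
have [eda|nda] := eqVneq d a; last first.
  have := nca d nda; rewrite /= eqxx sub1seq.
  by move: av; rewrite eq_sym (negPf nda) /= => ->.
rewrite {}eda {d av} /= eqxx /= in nca *.
have [av|nav] := boolP (a \in v).
  rewrite IH // ?/cons_new /= ?eqxx // => c nc.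
  by have := nca c nc; rewrite (negPf nc).
have -> : filter (predC1 a) v = v.
  by apply/all_filterP/allP => c cv /=; apply: contraNneq nav => <-.
rewrite /cons_new ohead_destutter; case: eqP => // e.
by move: nav; case: (v) e => //= b r [->]; rewrite mem_head.
Qed.

(** Converse of [destutter_leading]: as [a] is absent from [s], all its occurrences lie in the first
    run. *)
Lemma destutter_eq_cons a s v :
  destutter v = a :: s -> a \notin s ->
  destutter (filter (predC1 a) v) = s /\
  forall c, c != a -> ~~ subseq [:: c; a] v.
Proof.
move=> + nas; elim: v => // d v IH /=.
rewrite {1}/cons_new; case: eqP => [e1 e2|_ [-> es]].
  have [IH1 IH2] := IH e2; have ed : d = a by move: e1; rewrite e2 => -[].
  rewrite ed eqxx /=; split=> // c nc.
  by rewrite (negPf nc) IH2.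
rewrite eqxx /=.
have nav : a \notin v by rewrite -mem_destutter es.
split=> [|c nc].
  have -> : filter (predC1 a) v = v.
    by apply/all_filterP/allP => c cv /=; apply: contraNneq nav => <-.
  by [].
rewrite (negPf nc); apply: contra nav => /mem_subseq; apply.
by rewrite !inE eqxx orbT.
Qed.

End Destutter.

(** * The automaton and its language *)

Section Pushdown.

Variable T : finType.
Implicit Types (a c z : T) (s w : seq T) (U : {set T}).

(** [s] is the stack, top first, and [U] the set of letters not read yet. A new letter is pushed,
    then kept or popped at once; an old letter must be the top, and is then kept or popped. *)
Fixpoint accepts s U w : bool :=
  if w is a :: w' then
    (s != [::]) &&
    (if a \in U then accepts (a :: s) (U :\ a) w' || accepts s (U :\ a) w'
     else (ohead s == Some a) && (accepts s U w' || accepts (behead s) U w'))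
  else (s == [::]) && (U == set0).

(** The invariant that makes the automaton unambiguous: with equal neighbours on the stack, one word
    could be read from several stacks. *)
Definition proper_stack s U :=
  (destutter s == s) && all [predC U] s.

Lemma proper_stack_push s U a :
  a \in U -> proper_stack s U -> proper_stack (a :: s) (U :\ a).
Proof.
move=> aU /andP[/eqP ds /allP sU]; rewrite /proper_stack /= ds.
have nas : a \notin s by apply: contraL aU => /sU.
rewrite /cons_new !inE eqxx /=; case: ifP => [/eqP e|_].
  by move: nas; case: (s) e => //= b r [->]; rewrite mem_head.
rewrite eqxx /=; apply/allP => c /sU /= cU.
by rewrite !inE (negPf cU) andbF.
Qed.

Lemma proper_stack_sub s U (V : {set T}) :
  V \subset U -> proper_stack s U -> proper_stack s V.
Proof.
move=> /subsetP VU /andP[ds /allP sU]; rewrite /proper_stack ds /=.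
by apply/allP => c /sU /=; apply: contra; apply: VU.
Qed.

Lemma proper_stack_pop s U :
  proper_stack s U ->
  proper_stack (behead s) U /\
  (forall a, ohead s = Some a -> cons_new a (behead s) = s).
Proof.
case: s => //= a s /andP[/=]; rewrite {1}/cons_new.
case: ifP => [e /eqP e2|na /eqP[ds] /andP[_ sU]].
  by have /= := size_subseq (destutter_subseq s); rewrite e2 /= ltnn.
by split=> [|_ [<-]]; rewrite /proper_stack /cons_new -?(ohead_destutter s) ?na ?ds ?eqxx.
Qed.

Definition ends_outside U w :=
  if w is a :: w' then last a w' \notin U else true.

(** For a proper stack this is the language of [accepts s U]. The first clause makes [s] a function
    of [w]; the last letter lies outside [U] because the bottom of the stack outlives every pushed
    letter. *)
Definition noncrossing_over s U w : Prop :=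
  [/\ destutter (filter [predC U] w) = s,
      ends_outside U w,
      (forall z, z \in U -> z \in w),
      (forall z c, z \in U -> c \notin U -> ~~ subseq [:: z; c; z] w) &
      (forall z c, z \in U -> c \in U -> z != c ->
          ~~ subseq [:: z; c; z; c] w)].

(** Induction on the word: once read, a letter [a] of [U] counts as old, and the conditions for
    [U :\ a] and the next stack are translated back to [U] and [s]. *)
Lemma accepts_noncrossing s U w :
  proper_stack s U -> accepts s U w -> noncrossing_over s U w.
Proof.
elim: w s U => [|a w IH] s U ps /=.
  move=> /andP[/eqP-> /eqP->]; split=> //= z; rewrite ?inE //.
case/andP=> s0; case: ifPn => [aU|naU].
  have pU : proper_stack s (U :\ a) := proper_stack_sub (subD1set _ _) ps.
  have nas : a \notin s by case/andP: ps => _ /allP sU; apply: contraL aU => /sU.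
  have fE : filter [predC U] w = filter (predC1 a) (filter [predC U :\ a] w).
    rewrite -filter_predI; apply: eq_filter => c /=; rewrite !inE.
    by case: eqVneq => //= ->; rewrite aU.
  case/orP=> /IH.
    case/(_ (proper_stack_push aU ps)) => h1 h2 h3 h4 h5.
    have [h6 h7] := destutter_eq_cons h1 nas.
    have h8 c : c \notin U -> ~~ subseq [:: c; a] w.
      move=> cU; have nca : c != a by apply: contraNneq cU => ->.
      apply: contra (h7 c nca) => h.
        by rewrite subseq_filter h /= !inE eqxx (negPf cU) andbF.
    split.
    - by rewrite /= aU /= fE.
    (* If [w] ended with [a], the bottom letter of [s], which occurs in [w], would precede this [a],
       against [h8]. *)
    - case: w {IH fE h3 h4 h5 h6 h7} h1 h2 h8 => // b w h1 + h8.
      rewrite /ends_outside /= !inE negb_and negbK => /orP[/eqP e|//].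
      have cs : last a s \in s by case: (s) s0 => //= ? ? _; apply: mem_last.
      have cU : last a s \notin U by case/andP: ps => _ /allP; apply.
      have nca : last a s != a by apply: contraNneq nas => <-.
      have : last a s \in filter [predC U :\ a] (b :: w).
        by rewrite -mem_destutter h1 inE cs orbT.
      rewrite mem_filter => /andP[_]; have := h8 _ cU.
      rewrite (lastI b w) e mem_rcons inE (negPf nca) -cats1 => + cw.
      by rewrite (@cat_subseq _ [:: last a s] [:: a]) ?sub1seq ?mem_head.
    - move=> z zU; rewrite inE; case: eqVneq => //= nza.
      by apply: h3; rewrite !inE nza.
    - move=> z c zU cU.
      rewrite /=; case: (eqVneq z a) => [->|nza]; first exact: h8.
      by apply: h4; rewrite !inE ?nza // (negPf cU) andbF.
    (* A crossing that involves [a] would make another letter of [U] surround [a] in [w], where [a]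
       is already old. *)
    move=> z c zU cU nzc; rewrite /=; case: (eqVneq z a) => [e|nza].
      by rewrite e in nzc *; apply: h4; rewrite !inE ?eqxx // eq_sym nzc.
    case: (eqVneq c a) => [e|nca].
      have := h4 z c; rewrite e !inE eqxx zU nza => /(_ isT isT).
      apply: contra; apply: subseq_trans.
      exact: (prefix_subseq [:: z; a; z] [:: a]).
    by apply: h5 => //; rewrite !inE ?nza ?nca.
  case/(_ pU) => h1 h2 h3 h4 h5.
  (* Here [a] was popped at once: apart from [U :\ a], only letters of [s] remain, so [a] does not
     recur. *)
  have naw : a \notin w.
    apply: contra nas => aw; rewrite -h1 mem_destutter mem_filter aw.
    by rewrite /= !inE eqxx.
  have fE' : filter [predC U] w = filter [predC U :\ a] w.
    apply: eq_in_filter => c cw /=; rewrite !inE.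
    by case: eqVneq => //= e; move: naw; rewrite -e cw.
  have nsub r : a \in r -> ~~ subseq r w.
    by move=> ar; apply: contra naw => /mem_subseq; apply.
  split.
  - by rewrite /= aU /= fE'.
  - case: w {IH fE fE' h3 h4 h5 nsub} h1 h2 naw => [|b w] h1.
      by rewrite -h1 in s0.
    rewrite /ends_outside /= !inE negb_and negbK => /orP[/eqP e|//].
    by rewrite -[in X in X -> _]e -in_cons mem_last.
  - move=> z zU; rewrite inE; case: eqVneq => //= nza.
    by apply: h3; rewrite !inE nza.
  - move=> z c zU cU; rewrite /=; case: (eqVneq z a) => [e|nza].
      by apply: nsub; rewrite e !inE eqxx orbT.
    by apply: h4; rewrite !inE ?nza // (negPf cU) andbF.
  move=> z c zU cU nzc; rewrite /=; case: (eqVneq z a) => [e|nza].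
    by apply: nsub; rewrite e !inE eqxx orbT.
  case: (eqVneq c a) => [e|nca]; first by apply: nsub; rewrite e !inE eqxx orbT.
  by apply: h5 => //; rewrite !inE ?nza ?nca.
case/andP=> /eqP sa ok.
(* Whether [a] is kept or popped, [cons_new a] recovers [s] from the next stack [s'], so both
   transitions are treated together. *)
have [s' h1 es] : exists2 s', noncrossing_over s' U w & cons_new a s' = s.
  case/orP: ok => h.
    by exists s; [exact: IH|rewrite /cons_new sa eqxx].
  have [pb /(_ _ sa) eb] := proper_stack_pop ps.
  by exists (behead s); [exact: IH|].
case: h1 => h1 h2 h3 h4 h5; split.
- by rewrite /= naU /= h1.
- by case: (w) h2 => //=.
- by move=> z zU; rewrite inE h3 ?orbT.
- move=> z c zU cU; rewrite /=; case: eqVneq => [e|_]; last exact: h4.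
  by move: naU; rewrite -e zU.
move=> z c zU cU nzc; rewrite /=; case: eqVneq => [e|_]; last exact: h5.
by move: naU; rewrite -e zU.
Qed.

(** The word dictates the run: a new letter is kept iff it occurs again, and an old one iff the
    collapse of the remaining old letters still starts with it. *)
Lemma noncrossing_accepts s U w :
  proper_stack s U -> noncrossing_over s U w -> accepts s U w.
Proof.
elim: w s U => [|a w IH] s U ps [h1 h2 h3 h4 h5] /=.
  rewrite -h1 eqxx /=; apply/eqP/setP => z; rewrite inE.
  by apply/negP => /h3.
have lw : last a w \in filter [predC U] (a :: w).
  by rewrite mem_filter mem_last andbT.
have s0 : s != [::].
  by apply: contraTneq lw => s0; rewrite -mem_destutter h1 s0.
rewrite s0 /=; move: h1 => /=; case: (boolP (a \in U)) => [aU|naU] /= h1.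
  have pU : proper_stack s (U :\ a) := proper_stack_sub (subD1set _ _) ps.
  have nas : a \notin s by case/andP: ps => _ /allP sU; apply: contraL aU => /sU.
  have fE : filter [predC U] w = filter (predC1 a) (filter [predC U :\ a] w).
    rewrite -filter_predI; apply: eq_filter => c /=; rewrite !inE.
    by case: eqVneq => //= ->; rewrite aU.
  have g2 : ends_outside (U :\ a) w.
    by case: (w) h2 => //= b w'; rewrite /ends_outside !inE => /negPf->; rewrite andbF.
  have g3 z : z \in U :\ a -> z \in w.
    by rewrite !inE => /andP[nza /h3]; rewrite inE (negPf nza).
  have g4 z c : z \in U :\ a -> c \notin U -> ~~ subseq [:: z; c; z] w.
    rewrite !inE => /andP[nza zU] cU.
    by have := h4 z c zU cU; rewrite /= (negPf nza).
  have g5 z c : z \in U :\ a -> c \in U :\ a -> z != c ->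
      ~~ subseq [:: z; c; z; c] w.
    rewrite !inE => /andP[nza zU] /andP[nca cU] nzc.
    by have := h5 z c zU cU nzc; rewrite /= (negPf nza).
  apply/orP; have [aw|naw] := boolP (a \in w).
    left; apply: (IH _ _ (proper_stack_push aU ps)); split; [ | exact: g2 | by [] | | by [] ].
      rewrite -h1 fE (@destutter_leading _ a) // ?mem_filter ?aw /= ?inE ?eqxx //.
      move=> c nca; apply/negP => /[dup] /mem_subseq /(_ _ (mem_head _ _)).
      rewrite mem_filter /= !inE nca /= => /andP[cU _] h.
      have := h4 a c aU cU; rewrite /= eqxx => /negP; apply.
      by apply: subseq_trans h (filter_subseq _ _).
    move=> z c zU; rewrite !inE negb_and negbK => /orP[/eqP->|]; last exact: g4.
    move: zU; rewrite !inE => /andP[nza zU].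
    by have := h5 a z aU zU; rewrite eq_sym nza /= eqxx => /(_ isT).
  right; apply: (IH _ _ pU); split; [ | exact: g2 | by [] | | by [] ].
    rewrite -h1; congr destutter; apply: eq_in_filter => c cw /=; rewrite !inE.
    by case: eqVneq => //= e; move: naw; rewrite -e cw.
  move=> z c zU; rewrite !inE negb_and negbK => /orP[/eqP->|]; last exact: g4.
  by apply: contra naw => /mem_subseq; apply; rewrite !inE eqxx orbT.
have sa : ohead s = Some a by rewrite -h1 ohead_cons_new.
rewrite sa eqxx /=; apply/orP.
have g2 : ends_outside U w by case: (w) h2.
have g3 z : z \in U -> z \in w.
  by move=> zU; move: (h3 z zU); rewrite inE; case: eqVneq => //= e; rewrite -e zU in naU.
have g4 z c : z \in U -> c \notin U -> ~~ subseq [:: z; c; z] w.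
  move=> zU cU; have := h4 z c zU cU => /=; case: eqVneq => //= e.
  by rewrite -e zU in naU.
have g5 z c : z \in U -> c \in U -> z != c -> ~~ subseq [:: z; c; z; c] w.
  move=> zU cU nzc; have := h5 z c zU cU nzc => /=; case: eqVneq => //= e.
  by rewrite -e zU in naU.
move: h1; rewrite /cons_new; case: ifP => _ h1.
  by left; apply: IH.
right; apply: IH; first by case: (proper_stack_pop ps).
by split=> //; rewrite -h1.
Qed.

End Pushdown.

(* Walks of [n] steps from height [d] that first reach [0] at time [n]; a step is an
   optional push followed by an optional pop, and [j] counts the pushes. *)
Fixpoint walks (n j d : nat) : nat :=
  match n, d with
  | 0, _ => (j == 0) && (d == 0)
  | _, 0 => 0
  | n'.+1, d'.+1 =>
      (if j is j'.+1 then walks n' j' d.+1 + walks n' j' d else 0)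
      + (walks n' j d + walks n' j d')
  end.

(* ['C(n, k - 1)] with value [0] at [k = 0], where truncated subtraction would give [1]. *)
Definition binp n k := if k is k'.+1 then 'C(n, k') else 0.

Lemma binSp n k : 'C(n.+1, k) = 'C(n, k) + binp n k.
Proof. by case: k => [|k]; rewrite ?bin0 ?binS. Qed.

(** A two by two determinant of binomials, with the subtracted product moved to the left to stay in
    [nat]. By Pascal's rule it obeys the recursion of [walks]. *)
Lemma walksE n j d :
  walks n.+1 j d + 'C(n, j + d) * binp n j = 'C(n, j) * binp n (j + d).
Proof.
elim: n j d => [|n IH] j d.
  case: j d => [|j] [|[|d]] //=; rewrite ?addn0 ?addnS ?bin0n ?addn0 //=.
  - by case: j.
  - by case: j.
case: d => [|d]; first by rewrite addn0 /= mulnC.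
case: j => [|j].
  rewrite [walks _ _ _]/=; have := IH 0 d.+1; have := IH 0 d.
  rewrite /= !add0n !bin0 !muln0 !addn0 !mul1n => e0 e1.
  by rewrite [in RHS]binSp -e0 -e1 addnC.
have := IH j.+1 d.+1; have := IH j.+1 d; have := IH j d.+2; have := IH j d.+1.
set W := walks.
have -> : W n.+2 j.+1 d.+1 = W n.+1 j d.+2 + W n.+1 j d.+1
  + (W n.+1 j.+1 d.+1 + W n.+1 j.+1 d) by [].
rewrite [binp _ (j.+1 + d.+1)]/= [binp _ j.+1]/= ![j.+1 + _]addSn ![j + _.+1]addnS.
rewrite ![binp _ _.+1]/= !binSp ![binp _ _.+1]/=.
nia.
Qed.

Lemma mul_binp n k : n.+1 * binp n k = k * 'C(n.+1, k).
Proof. by case: k => [|k]; rewrite ?muln0 //= mul_bin_diag. Qed.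

(** Multiplying the determinant by the length and absorbing with [mul_binp] gives the coefficients
    [j + d] and [j], whose difference is [d]. *)
Lemma walks_closed n j d : n * walks n j d = d * ('C(n, j) * 'C(n, j + d)).
Proof.
case: n => [|n]; first by case: j d => [|j] [|d]; rewrite //= ?bin0n ?muln0.
have := walksE n j d; have := mul_binp n j; have := mul_binp n (j + d).
rewrite !binSp => e1 e2 e3.
have : n.+1 * (walks n.+1 j d + 'C(n, j + d) * binp n j) =
  n.+1 * ('C(n, j) * binp n (j + d)) by rewrite e3.
nia.
Qed.

(** * Counting accepted words *)

Lemma card_tuple_cons (T : finType) n (p : pred (seq T)) :
  #|[set w : n.+1.-tuple T | p w]| =
  \sum_a #|[set w : n.-tuple T | p (a :: w)]|.
Proof.
rewrite -sum1_card (partition_big (@thead n T) xpredT) //=.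
apply: eq_bigr => a _; rewrite -sum1_card.
rewrite (reindex_onto (cons_tuple a) (@behead_tuple n.+1 T)) /=.
  apply: eq_bigl => w; rewrite !inE theadE eqxx andbT.
  by rewrite andb_idr // => _; apply/eqP/val_inj.
by move=> w /andP[_ /eqP <-]; rewrite [RHS]tuple_eta; apply: val_inj.
Qed.

(** The pushes and pops of a run form a walk; the factorial counts the orders in which the new
    letters can appear. *)
Lemma card_accepts (T : finType) n (s : seq T) (U : {set T}) :
  proper_stack s U ->
  #|[set w : n.-tuple T | accepts s U w]| = (#|U|)`! * walks n #|U| (size s).
Proof.
elim: n s U => [|n IH] s U ps.
  have -> : [set w : 0.-tuple T | accepts s U w] =
            if (s == [::]) && (U == set0) then [set [tuple]] else set0.
    by apply/setP => w; rewrite (tuple0 w) !inE /=; case: ifP; rewrite !inE ?eqxx.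
  rewrite -size_eq0 -cards_eq0 /= andbC; case: ifP => [/andP[/eqP-> _]|_].
    by rewrite cards1.
  by rewrite cards0 muln0.
rewrite (@card_tuple_cons T n (accepts s U)).
case: s ps => [|c s] ps.
  by rewrite big1 ?muln0 // => a _; apply: eq_card0 => w; rewrite !inE.
have [pb _] := proper_stack_pop ps; rewrite /= in pb.
have cU : c \notin U by case/andP: ps => _ /andP[].
rewrite (bigID (mem U)) /= [X in _ + X = _](bigD1 c) //= [X in _ + (_ + X) = _]big1 ?addn0; last first.
  move=> a /andP[aU nac]; apply: eq_card0 => w; rewrite !inE (negPf aU).
  by case: eqP => // -[e]; rewrite e eqxx in nac.
(* The two branches of a transition accept disjoint sets of words, because an accepted word
   determines its stack. *)
have disj (s1 s2 : seq T) V w : s1 != s2 -> proper_stack s1 V -> proper_stack s2 V ->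
    accepts s1 V w -> accepts s2 V w -> false.
  move=> /eqP ns p1 p2 /(accepts_noncrossing p1)[e1 _ _ _ _].
  by move=> /(accepts_noncrossing p2)[e2 _ _ _ _]; case: ns; rewrite -e1 -e2.
have nts r (b : T) : r != b :: r :> seq T.
  by apply/eqP => /(congr1 size) /= /n_Sn.
have cardU (s1 s2 : seq T) V : s1 != s2 -> proper_stack s1 V -> proper_stack s2 V ->
    #|[set w : n.-tuple T | accepts s1 V w || accepts s2 V w]| =
    (#|V|)`! * (walks n #|V| (size s1) + walks n #|V| (size s2)).
  move=> ns p1 p2; rewrite mulnDr -!IH // -cardsUI [X in _ = _ + X]eq_card0.
    by rewrite addn0; apply: eq_card => w; rewrite !inE.
  by move=> w; rewrite !inE; apply/negP => /andP[a1 a2]; move: (disj _ _ _ _ ns p1 p2 a1 a2).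
rewrite [X in _ + X = _](_ : _ = (#|U|)`! * (walks n #|U| (size s).+1 + walks n #|U| (size s))); last first.
  rewrite (negPf cU) eqxx /=; apply: cardU => //.
  by rewrite eq_sym.
rewrite [RHS]mulnDr; congr (_ + _).
rewrite (eq_bigr (fun=> (#|U|.-1)`! * (walks n #|U|.-1 (size s).+2 + walks n #|U|.-1 (size s).+1))).
  rewrite sum_nat_const; case: #|U| => [|k] //=.
  by rewrite factS mulnA.
move=> a aU; rewrite aU.
have ps' := proper_stack_push aU ps.
rewrite cardU //.
- by rewrite (cardsD1 a U) aU.
- by rewrite eq_sym.
exact: proper_stack_sub (subD1set _ _) ps.
Qed.

(** * Switches in cyclic words *)

Lemma periodic_mulD (X : Type) (f : nat -> X) n :
  (forall t, f (t + n) = f t) -> forall k t, f (t + k * n) = f t.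
Proof. by move=> fDn; elim=> [|k IH] t; rewrite ?addn0 // mulSn addnCA addnC fDn. Qed.

Lemma periodic_mod (X : Type) (f : nat -> X) n :
  (forall t, f (t + n) = f t) -> forall t, f (t %% n) = f t.
Proof. by move=> fDn t; rewrite {2}(divn_eq t n) addnC periodic_mulD. Qed.

Section CyclicWord.

Variables (T : finType) (n : nat) (u : nat -> T).
Implicit Types (a b c : T) (s t i j k l : nat).

(** The time from [t] to the next throw of [a], which is 0 if [a] is thrown at time [t]. *)
Definition wait t a := index a [seq u i | i <- iota t n].

Definition switch_at a b t := (u t == a) && (wait t.+1 b < wait t.+1 a).

Definition switches a b := \sum_(t < n) switch_at a b t.

(** This will be the level of ball [a] at time [t], counted from 0: balls are stacked in the order
    of their next throws. *)
Definition rank t a := #|[set b | wait t b < wait t a]|.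

Definition recurrent := (forall t, u (t + n) = u t) /\ (forall a, exists t, u t = a).

Hypothesis n_gt0 : 0 < n.
Hypothesis u_rec : recurrent.

Let uDn t : u (t + n) = u t. Proof. by case: u_rec. Qed.

Lemma recurrent_after t a : exists2 k, k < n & u (t + k) = a.
Proof.
have [s <-] := u_rec.2 a.
(* The residue of [s - t] modulo [n], written with truncated subtraction in mind. *)
exists ((s + (n - t %% n)) %% n); first by rewrite ltn_mod.
rewrite -(periodic_mod uDn) modnDmr (periodic_mod uDn) -(periodic_mulD uDn (t %/ n).+1 s).
congr u; rewrite {1}(divn_eq t n) mulSn; have := ltn_pmod t n_gt0; lia.
Qed.

Lemma nth_window x t k : k < n -> nth x [seq u i | i <- iota t n] k = u (t + k).
Proof. by move=> kn; rewrite (nth_map 0) ?size_iota // nth_iota. Qed.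

Lemma wait_lt t a : wait t a < n.
Proof.
have [k kn <-] := recurrent_after t a.
rewrite -[X in _ < X](size_iota t n) -(size_map u) index_mem.
by rewrite map_f // mem_iota leq_addr ltn_add2l.
Qed.

Lemma wait_hit t a : u (t + wait t a) = a.
Proof.
rewrite -(@nth_window a) ?wait_lt // nth_index //.
by rewrite -index_mem size_map size_iota wait_lt.
Qed.

Lemma wait_le t k a : u (t + k) = a -> wait t a <= k.
Proof.
move=> e; have [//|kw] := leqP (wait t a) k.
have := before_find a kw; rewrite nth_window ?(ltn_trans kw) ?wait_lt //.
by rewrite /= e eqxx.
Qed.

Lemma wait_cur t : wait t (u t) = 0.
Proof. by apply/eqP; rewrite -leqn0 wait_le // addn0. Qed.

Lemma waitS t a : u t != a -> wait t a = (wait t.+1 a).+1.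
Proof.
move=> na; apply/eqP; rewrite eqn_leq; apply/andP; split.
  by apply: wait_le; rewrite addnS -addSn wait_hit.
have := wait_hit t a; case: (wait t a) => [|k]; first by rewrite addn0 => e; rewrite e eqxx in na.
by rewrite addnS -addSn => /wait_le.
Qed.

Lemma waitDn t a : wait (t + n) a = wait t a.
Proof.
apply/eqP; rewrite eqn_leq; apply/andP; split; apply: wait_le.
  by rewrite addnAC uDn wait_hit.
by rewrite -uDn addnAC wait_hit.
Qed.

Lemma wait_inj t : injective (wait t).
Proof. by move=> a b e; rewrite -(wait_hit t a) e wait_hit. Qed.

(** A switch is a rise, from false to true, of the indicator that [b] is due before [a]. *)
Lemma switch_atE a b t : a != b ->
  switch_at a b t = ~~ (wait t b < wait t a) && (wait t.+1 b < wait t.+1 a).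
Proof.
move=> nab; rewrite /switch_at; case: eqP => [<-|/eqP na]; first by rewrite wait_cur.
have [e|nb] := eqVneq (u t) b.
  by rewrite -e wait_cur [wait t a]waitS.
by rewrite (waitS na) (waitS nb) ltnS andNb.
Qed.

Lemma switch_atDn a b t : switch_at a b (t + n) = switch_at a b t.
Proof. by rewrite /switch_at -addSn !waitDn uDn. Qed.

Lemma sum_periodic_shift (G : nat -> nat) k :
  (forall t, G (t + n) = G t) -> \sum_(t < n) G (t + k) = \sum_(t < n) G t.
Proof.
move=> GDn; elim: k => [|k <-]; first by apply: eq_bigr => t _; rewrite addn0.
rewrite -(big_mkord xpredT (fun t => G (t + k.+1))) -(big_mkord xpredT (fun t => G (t + k))).
case: (n) n_gt0 GDn => // m _ GDn.
rewrite big_nat_recr //= big_nat_recl //= addnC; congr (_ + _).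
  by rewrite addnS addnC -addnS GDn.
by apply: eq_bigr => i _; rewrite addSnnS.
Qed.

(** Around the cycle the indicator that [b] is due before [a] rises as often as it falls, and its
    falls are the switches from [b] to [a]. *)
Lemma switches_sym a b : switches a b = switches b a.
Proof.
have [->//|nab] := eqVneq a b.
pose p t : nat := wait t b < wait t a.
have sp : \sum_(t < n) p t.+1 = \sum_(t < n) p t.
  rewrite -(@sum_periodic_shift p 1); last by move=> t; rewrite /p !waitDn.
  by apply: eq_bigr => t _; rewrite addn1.
apply/eqP; rewrite -(eqn_add2r (\sum_(t < n) p t)) -{2}sp -!big_split /=.
apply/eqP/eq_bigr => t _; rewrite !switch_atE // 1?eq_sym // /p.
have ne k : wait k a != wait k b by rewrite (inj_eq (@wait_inj k)).
by case: ltngtP (ne t) => // _ _; case: ltngtP (ne t.+1).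
Qed.

Lemma switch_between a b i j : a != b -> i < j -> u i = a -> u j = b ->
  exists2 s, i <= s < j & switch_at a b s.
Proof.
move=> nab ij ui uj.
have [/hasP[s]|/hasPn no] := boolP (has (switch_at a b) (index_iota i j)).
  by rewrite mem_index_iota; exists s.
have: forall k, i + k <= j -> ~~ (wait (i + k) b < wait (i + k) a).
  elim=> [|k IH] kj; first by rewrite addn0 -ui wait_cur.
  have := no (i + k); rewrite mem_index_iota leq_addr addnS switch_atE //.
  by rewrite IH /= => [|]; [apply; lia|lia].
move/(_ (j - i)); rewrite subnKC ?(ltnW ij) // => /(_ (leqnn _)).
have : 0 < wait j a by rewrite waitS // uj eq_sym.
by rewrite -[in wait j b]uj wait_cur => ->.
Qed.

Lemma switches_eq0 a : switches a a = 0.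
Proof. by rewrite /switches big1 // => t _; rewrite /switch_at ltnn andbF. Qed.

Lemma switches_card a b : switches a b = #|[set t : 'I_n | switch_at a b t]|.
Proof.
rewrite -sum1_card /switches [RHS]big_mkcond /=.
by apply: eq_bigr => t _; rewrite inE; case: switch_at.
Qed.

Lemma switch_at_mod a b s : switch_at a b (s %% n) = switch_at a b s.
Proof. exact: (periodic_mod (f := switch_at a b) (switch_atDn a b)). Qed.

Lemma switches_gt0 a b : a != b -> 0 < switches a b.
Proof.
move=> nab; have [t ut] := u_rec.2 a.
have [k kn uk] := recurrent_after t.+1 b.
have [s _ sw] := switch_between nab (leq_addr k t.+1 : t < _) ut uk.
rewrite switches_card; apply/card_gt0P; exists (Ordinal (ltn_pmod s n_gt0)).
by rewrite inE switch_at_mod.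
Qed.

Lemma switches_gt1 a b i j k l : a != b -> i < j < k -> k < l < i + n ->
  u i = a -> u j = b -> u k = a -> u l = b -> 1 < switches a b.
Proof.
move=> nab /andP[ij jk] /andP[kl lin] ui uj uk ul.
have [s sij ss] := switch_between nab ij ui uj.
have [r rkl rr] := switch_between nab kl uk ul.
rewrite switches_card; apply/card_gt1P.
exists (Ordinal (ltn_pmod s n_gt0)), (Ordinal (ltn_pmod r n_gt0)).
split; rewrite ?inE ?switch_at_mod //; apply/eqP => /(congr1 val) /= e.
(* Equal residues would make [r - s], which lies strictly between 0 and [n], a multiple of [n]. *)
have: (r - s) %% n = 0.
  by apply/eqP; rewrite -/(dvdn n (r - s)) -eqn_mod_dvd ?e ?eqxx //; lia.
by rewrite modn_small; lia.
Qed.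

(** Two switches give the pattern a b a b around the cycle. If its last [b] falls beyond the end of
    the word, moving it back by one period gives b a b a. *)
Lemma switches_gt1_pattern a b : 1 < switches a b ->
  exists c d, exists i j k l,
    [/\ [|| (c == a) && (d == b) | (c == b) && (d == a)], i < j < k, k < l < n
      & [/\ u i = c, u j = d, u k = c & u l = d]].
Proof.
rewrite switches_card => /card_gt1P[s [r []]]; rewrite !inE => ss sr nsr.
wlog lsr : s r ss sr nsr / s < r.
  move=> wl; have [sr'|rs|e] := ltngtP s r; first exact: (wl s r).
    by apply: (wl r s) => //; rewrite eq_sym.
  by rewrite (val_inj e) eqxx in nsr.
case/andP: ss => /eqP us s1; case/andP: sr => /eqP ur r1.
(* After the throws at [s] and [r], ball [a] returns by [r] and [s + n] respectively, and [b] comes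
   earlier each time. *)
have h1 : wait s.+1 a <= r - s.+1 by apply: wait_le; rewrite subnKC.
have h2 : wait r.+1 a <= s + n - r.+1.
  by apply: wait_le; rewrite subnKC ?uDn // (leq_trans (ltn_ord r)) ?leq_addl.
have u1 := wait_hit s.+1 b; have u2 := wait_hit r.+1 b.
have rn := ltn_ord r.
have [lt|ge] := ltnP (r.+1 + wait r.+1 b) n.
  exists a, b, s, (s.+1 + wait s.+1 b), r, (r.+1 + wait r.+1 b).
  by split; rewrite ?eqxx //; lia.
exists b, a, (r.+1 + wait r.+1 b - n), s, (s.+1 + wait s.+1 b), r.
split; rewrite ?eqxx ?orbT //; try lia.
by split=> //; rewrite -uDn subnK.
Qed.

Lemma rank_lt t a b : wait t a < wait t b -> rank t a < rank t b.
Proof.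
move=> ab; apply: proper_card; apply/properP; split.
  by apply/subsetP => c; rewrite !inE => /ltn_trans; apply.
by exists a; rewrite !inE ?ltnn.
Qed.

Lemma rank_bound t a : rank t a < #|T|.
Proof.
rewrite -cardsT; apply: proper_card; apply/properP; split; first exact: subsetT.
by exists a; rewrite !inE ?ltnn.
Qed.

Lemma rank_inj t : injective (rank t).
Proof.
move=> a b e; case: (ltngtP (wait t a) (wait t b)) => [/rank_lt|/rank_lt|/wait_inj //].
  by rewrite e ltnn.
by rewrite e ltnn.
Qed.

Lemma rank_cur t : rank t (u t) = 0.
Proof. by apply: eq_card0 => a; rewrite !inE wait_cur. Qed.

Lemma rankDn t a : rank (t + n) a = rank t a.
Proof. by rewrite /rank; apply: eq_card => b; rewrite !inE !waitDn. Qed.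

(** The thrown ball leaves the front of [a], and comes back before [a] if it is due again sooner.
    This is the action of a card on levels. *)
Lemma rankS t a : u t != a ->
  rank t a + (wait t.+1 (u t) < wait t.+1 a) = (rank t.+1 a).+1.
Proof.
move=> na; rewrite /rank [in LHS](cardsD1 (u t)) [in RHS](cardsD1 (u t)) !inE.
rewrite wait_cur waitS //= add1n addSn addnC; congr (_ + _).+1.
apply: eq_card => b; rewrite !inE; case: eqVneq => //= nb.
by rewrite [wait t b]waitS 1?eq_sym // ltnS.
Qed.

(** A thrown ball lands above the balls due before it, and these are the balls to which it switches
    at that throw. The left side is the number of crossings. *)
Lemma sum_rank_switches :
  \sum_(t < n) rank t.+1 (u t) = \sum_a \sum_b switches a b.
Proof.
under [RHS]eq_bigr do rewrite /switches exchange_big /=.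
rewrite [RHS]exchange_big /=; apply: eq_bigr => t _.
rewrite (bigD1 (u t)) //= [X in _ + X]big1 ?addn0; last first.
  by move=> a na; rewrite big1 // => b _; rewrite /switch_at eq_sym (negPf na).
rewrite /rank -sum1_card big_mkcond /=; apply: eq_bigr => b _.
by rewrite inE /switch_at eqxx /=; case: ltnP.
Qed.

End CyclicWord.

(** * Card sequences and words *)

Section Words.

Variables (T : finType) (m : nat).
Implicit Types (w : m.+1.-tuple T).

Definition cyc w t := tnth w (inord (t %% m.+1)).

Lemma cyc_small w (t : 'I_m.+1) : cyc w t = tnth w t.
Proof. by rewrite /cyc modn_small // inord_val. Qed.

Lemma cycDn w t : cyc w (t + m.+1) = cyc w t.
Proof. by rewrite /cyc modnDr. Qed.

Lemma cyc_mod w t : cyc w (t %% m.+1) = cyc w t.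
Proof. by rewrite /cyc modn_mod. Qed.

Lemma recurrent_cyc w : recurrent m.+1 (cyc w) <-> forall a, a \in val w.
Proof.
split=> [[_ sw] a|sw].
  by have [t <-] := sw a; apply: mem_tnth.
split=> [|a]; first exact: cycDn.
by have /tnthP[t ->] := sw a; exists t; rewrite cyc_small.
Qed.

Definition all_letters w := [forall a, a \in val w].

Lemma all_lettersP w : reflect (recurrent m.+1 (cyc w)) (all_letters w).
Proof.
by apply: (iffP forallP) => h; apply/recurrent_cyc.
Qed.

Definition total_switches w := \sum_a \sum_c switches m.+1 (cyc w) a c.

End Words.

Lemma val_card_fun b (i j : 'I_b) :
  card_fun i j = (if j == 0 :> nat then i : nat else if j <= i then j.-1 else j) :> nat.
Proof. by rewrite /card_fun; case: eqP => // _; case: leqP. Qed.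

(** * Words as card sequences with named balls *)

Section CardsOfWords.

Variable b' m : nat.
Local Notation b := b'.+1.
Local Notation n := m.+1.
Implicit Types (A w : n.-tuple 'I_b) (s : {ffun 'I_b -> 'I_b}).

Definition cards_of w : n.-tuple 'I_b :=
  [tuple inord (rank n (cyc w) t.+1 (cyc w t)) | t < n].

Definition start_of w : {ffun 'I_b -> 'I_b} := [ffun a => inord (rank n (cyc w) 0 a)].

Fixpoint level A s t (a : 'I_b) : 'I_b :=
  if t is t'.+1 then card_fun (cyc A t') (level A s t' a) else s a.

(** For injective [s] exactly one ball is at level 0 at time [t], and [pick] finds it. *)
Definition thrown A s t := odflt ord0 [pick a | level A s t a == ord0].

Definition word_of A s : n.-tuple 'I_b := [tuple thrown A s t | t < n].

Lemma card_fun_rank (u : nat -> 'I_b) t a : recurrent n u ->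
  card_fun (inord (rank n u t.+1 (u t))) (inord (rank n u t a)) =
  inord (rank n u t.+1 a) :> 'I_b.
Proof.
move=> ru; have rb k c : rank n u k c < b by rewrite -[X in _ < X]card_ord rank_bound.
apply: val_inj; rewrite /= val_card_fun !inordK //.
have [<-|na] := eqVneq (u t) a; first by rewrite rank_cur.
have := rankS (ltn0Sn m) ru na; case: ltngtP => [lt|gt|e] h.
- have h1 := rank_lt lt.
  by case: eqP => [|_]; [|case: leqP]; lia.
- have h1 := rank_lt gt.
  by case: eqP => [|_]; [|case: leqP]; lia.
by case/eqP: na; apply: wait_inj e.
Qed.

Lemma level_prod A s t a :
  level A s t a = (\prod_(k < t) Defs.card_perm (cyc A k))%g (s a).
Proof.
elim: t => [|t IH]; first by rewrite big_ord0 perm1.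
by rewrite big_ord_recr /= permM permE IH.
Qed.

Lemma level_pi A s a : level A s n a = pi_seq A (s a).
Proof.
rewrite level_prod /pi_seq; congr (fun_of_perm _ _).
by apply: eq_bigr => k _; rewrite cyc_small.
Qed.

Lemma crossings_cards_of w : recurrent n (cyc w) ->
  crossings (cards_of w) = \sum_a \sum_c switches n (cyc w) a c.
Proof.
move=> rw; rewrite -sum_rank_switches //; apply: eq_bigr => t _.
by rewrite tnth_mktuple inordK // -[X in _ < X]card_ord rank_bound.
Qed.

Section FromWord.

Variable w : n.-tuple 'I_b.
Hypothesis rw : recurrent n (cyc w).

Let rb k c : rank n (cyc w) k c < b.
Proof. by rewrite -[X in _ < X]card_ord rank_bound. Qed.

Lemma level_cards_of t a : level (cards_of w) (start_of w) t a = inord (rank n (cyc w) t a).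
Proof.
elim: t => [|t IH] /=; first by rewrite ffunE.
rewrite IH -(card_fun_rank _ _ rw); congr (card_fun _ _).
rewrite {1}/cyc tnth_mktuple inordK ?ltn_mod // cyc_mod; congr inord.
pose f k := rank n (cyc w) k.+1 (cyc w t).
by apply: (periodic_mod (f := f)) => k; rewrite /f -addSn rankDn.
Qed.

Lemma start_of_inj : injective (start_of w).
Proof.
move=> a c; rewrite !ffunE => /(congr1 val); rewrite /= !inordK //.
exact: (rank_inj (ltn0Sn m) rw).
Qed.

(** Ranks have period [n], so every ball is back on its initial level. *)
Lemma pi_cards_of : pi_seq (cards_of w) = 1%g.
Proof.
apply/permP => x; have /codomP[a ->] := inj_card_onto start_of_inj (leqnn _) x.
by rewrite -level_pi level_cards_of perm1 ffunE -[n]add0n rankDn.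
Qed.

(** Without the top card, the ball starting on the top level would stay there forever, whereas
    recurrence has it thrown from level 0. *)
Lemma cards_of_top : 0 < b' -> uses_top_card (cards_of w).
Proof.
move=> b'0; apply: contraT => /existsPn nt.
have /codomP[a sa] := inj_card_onto start_of_inj (leqnn _) ord_max.
have top t : level (cards_of w) (start_of w) t a = ord_max.
  elim: t => //= t ->; apply: val_inj; rewrite /= val_card_fun /=.
  rewrite eqn0Ngt b'0 /=; case: leqP => //= le.
  have := nt (inord (t %% n)); rewrite -/(cyc _ t) eqSS.
  by rewrite eqn_leq le -ltnS ltn_ord.
have [t ut] := rw.2 a; have := top t; rewrite level_cards_of -ut rank_cur //.
by move/(congr1 val); rewrite /= inordK //= => e; rewrite -e in b'0.
Qed.

Lemma word_of_cards : word_of (cards_of w) (start_of w) = w.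
Proof.
apply: eq_from_tnth => t; rewrite tnth_mktuple /thrown.
have rk0 a : (level (cards_of w) (start_of w) t a == ord0) = (a == cyc w t).
  rewrite level_cards_of -val_eqE /= inordK // -(rank_cur (ltn0Sn m) rw t).
  exact: (inj_eq (rank_inj (ltn0Sn m) rw (t := t))).
case: pickP => [a|/(_ (cyc w t))]; rewrite rk0; first by move/eqP->; rewrite cyc_small.
by rewrite eqxx.
Qed.

End FromWord.

Section FromCards.

Variables (A : n.-tuple 'I_b) (s : {ffun 'I_b -> 'I_b}).
Hypotheses (s_inj : injective s) (A_id : pi_seq A = 1%g).

Lemma level_inj t : injective (level A s t).
Proof. by elim: t => [|t IH] //=; move=> a c /card_fun_inj /IH. Qed.

Lemma level_thrown t : level A s t (thrown A s t) = ord0.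
Proof.
rewrite /thrown; case: pickP => [a /eqP //|no].
have /codomP[a e] := inj_card_onto (@level_inj t) (leqnn _) ord0.
by have := no a; rewrite -e eqxx.
Qed.

Lemma levelDn t a : level A s (t + n) a = level A s t a.
Proof.
elim: t => [|t IH]; first by rewrite add0n level_pi A_id perm1.
by rewrite addSn /= IH cycDn.
Qed.

Lemma thrownDn t : thrown A s (t + n) = thrown A s t.
Proof. by rewrite /thrown; congr odflt; apply: eq_pick => a; rewrite levelDn. Qed.

Lemma cyc_word_of t : cyc (word_of A s) t = thrown A s t.
Proof.
rewrite /cyc tnth_mktuple inordK ?ltn_mod //.
exact: (periodic_mod (f := thrown A s) thrownDn).
Qed.

Lemma level_eq0 t a : (level A s t a == 0 :> nat) = (thrown A s t == a).
Proof.
apply/eqP/eqP => [e|<-]; last by rewrite level_thrown.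
by apply: (@level_inj t); rewrite level_thrown; apply: val_inj.
Qed.

(* A ball that is never thrown can only sink, hence stays on its level, but the
   top card moves every ball that is not thrown. *)
Lemma word_of_recurrent : uses_top_card A -> recurrent n (cyc (word_of A s)).
Proof.
case/existsP => k /eqP top; split; first exact: cycDn.
move=> a; have [/hasP[t _ /eqP e]|/hasPn no] :=
  boolP (has (fun t => thrown A s t == a) (iota 0 n)).
  by exists t; rewrite cyc_word_of.
have pos t : t < n -> level A s t a != 0 :> nat.
  by move=> tn; rewrite level_eq0 no // mem_iota.
have dec i j : i <= j <= n -> level A s j a <= level A s i a.
  elim: j => [|j IH] /andP[ij jn]; first by move: ij; rewrite leqn0 => /eqP->.
  move: ij; rewrite leq_eqVlt => /predU1P[->//|ij].
  apply: leq_trans (IH _); last by rewrite -ltnS ij ltnW.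
  rewrite /= val_card_fun (negPf (pos _ jn)); case: ifP => _ //=; exact: leq_pred.
have kn := ltn_ord k.
have h1 := dec 0 k; have h2 := dec k.+1 n; rewrite -[X in level _ _ X]add0n levelDn in h2.
have := pos _ kn; have : level A s k.+1 a = (level A s k a).-1 :> nat.
  rewrite /= val_card_fun (negPf (pos _ kn)) cyc_small.
  by have := ltn_ord (level A s k a); rewrite -[X in _ < X]top ltnS => ->.
lia.
Qed.

Hypothesis A_top : uses_top_card A.

Let v := cyc (word_of A s).
Let rv : recurrent n v := word_of_recurrent A_top.

(** Balls are thrown in the order of their levels: a card preserves the order of two balls that it
    does not throw, and a ball above another is not at level 0. Induction on the wait of [c]. *)
Lemma level_wait t a c : level A s t a < level A s t c -> wait n v t a < wait n v t c.
Proof.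
move: {2}(wait n v t c) (leqnn (wait n v t c)) => k.
elim: k t => [|k IH] t kw lt.
  have vc : v t = c.
    by rewrite -[t]addn0 -(wait_hit (ltn0Sn m) rv t c); congr v; lia.
  have /eqP e : level A s t c == 0 :> nat by rewrite level_eq0 -cyc_word_of -/v vc.
  by rewrite e in lt.
have [vc|nc] := eqVneq (v t) c.
  have /eqP e : level A s t c == 0 :> nat by rewrite level_eq0 -cyc_word_of -/v vc.
  by rewrite e in lt.
rewrite (waitS (ltn0Sn m) rv nc) in kw *.
have [<-|na] := eqVneq (v t) a; first by rewrite wait_cur.
rewrite (waitS (ltn0Sn m) rv na) ltnS; apply: IH => //.
have la : level A s t a != 0 :> nat by rewrite level_eq0 -cyc_word_of.
have lc : level A s t c != 0 :> nat by rewrite level_eq0 -cyc_word_of.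
rewrite /= !val_card_fun (negPf la) (negPf lc).
by case: ifP; case: ifP; lia.
Qed.

Lemma rank_level t a : rank n v t a = level A s t a.
Proof.
rewrite /rank; transitivity #|[set c | level A s t c < level A s t a]|.
  apply: eq_card => c; rewrite !inE; apply/idP/idP; last exact: level_wait.
  apply: contraTT; rewrite -!leqNgt leq_eqVlt => /predU1P[|/level_wait/ltnW //].
  by move/val_inj/level_inj->.
rewrite -(card_imset _ (@level_inj t)).
transitivity #|[set c : 'I_b | c < level A s t a]|.
  apply: eq_card => c; rewrite inE; apply/imsetP/idP => [[d]|lt].
    by rewrite inE => + ->.
  have /codomP[d e] := inj_card_onto (@level_inj t) (leqnn _) c.
  by exists d; rewrite // inE -e.
rewrite -sum1dep_card -(big_ord_widen _ (fun=> 1)) ?(ltnW (ltn_ord _)) //.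
by rewrite sum1_card card_ord.
Qed.

Lemma start_of_word : start_of (word_of A s) = s.
Proof.
by apply/ffunP => a; rewrite ffunE rank_level /= inord_val.
Qed.

Lemma cards_of_word : cards_of (word_of A s) = A.
Proof.
apply: eq_from_tnth => t; rewrite tnth_mktuple rank_level inord_val cyc_word_of /=.
by rewrite level_thrown /card_fun /= cyc_small.
Qed.

End FromCards.

Lemma card_bij (S1 S2 : finType) (X : {set S1}) (Y : {set S2}) f g :
  {in X, forall x, f x \in Y /\ g (f x) = x} ->
  {in Y, forall y, g y \in X /\ f (g y) = y} -> #|X| = #|Y|.
Proof.
move=> fX gY; rewrite -(@card_in_imset _ _ f X).
  apply: eq_card => y; apply/imsetP/idP => [[x xX ->]|yY]; first by case: (fX x xX).
  by case: (gY y yY) => h e; exists (g y).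
by move=> x1 x2 x1X x2X e; rewrite -(fX _ x1X).2 e (fX _ x2X).2.
Qed.

(** A word amounts to a card sequence together with a placing of the named balls on the initial
    levels; the factorial counts these placings. *)
Lemma card_words_cards N : 0 < b' ->
  #|[set w : n.-tuple 'I_b | all_letters w && (total_switches w == N)]| =
  b`! * #|[set A : n.-tuple 'I_b |
             [&& uses_top_card A, pi_seq A == 1%g & crossings A == N]]|.
Proof.
move=> b'0.
have -> : b`! = #|[set s : {ffun 'I_b -> 'I_b} | injectiveb s]|.
  by rewrite card_inj_ffuns !card_ord ffactnn.
rewrite -cardsX.
apply: (@card_bij _ _ _ _ (fun w => (start_of w, cards_of w)) (fun p => word_of p.2 p.1)).
  move=> w; rewrite inE => /andP[/all_lettersP rw /eqP cw]; split; last exact: word_of_cards.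
  rewrite !inE /= cards_of_top // pi_cards_of // crossings_cards_of // eqxx.
  rewrite -cw eqxx !andbT; exact/injectiveP/start_of_inj.
move=> [s A]; rewrite !inE /= => /andP[/injectiveP si /and3P[At /eqP Ai /eqP Ac]].
have rw := word_of_recurrent si Ai At; have eA := cards_of_word si Ai At.
split; last by rewrite start_of_word // eA.
by rewrite (introT (all_lettersP _) rw) /total_switches -crossings_cards_of // eA Ac eqxx.
Qed.

End CardsOfWords.

(** * Words with a marked switch *)

Section Rotation.

Variables (T : finType) (m : nat).
Local Notation n := m.+1.
Implicit Types (w : n.-tuple T) (p q : T * T).

Lemma wait_shift (u v : nat -> T) k t a :
  (forall i, v i = u (i + k)) -> wait n v t a = wait n u (t + k) a.
Proof.
move=> vu; rewrite /wait addnC iotaDl -map_comp; congr index.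
by apply: eq_map => i; rewrite vu /= addnC.
Qed.

Lemma switch_at_shift (u v : nat -> T) k a b t :
  (forall i, v i = u (i + k)) -> switch_at n v a b t = switch_at n u a b (t + k).
Proof. by move=> vu; rewrite /switch_at vu !(wait_shift _ _ vu). Qed.

Definition shift k w : n.-tuple T := [tuple cyc w (i + k) | i < n].

Lemma cyc_shift k w t : cyc (shift k w) t = cyc w (t + k).
Proof.
by rewrite {1}/cyc tnth_mktuple inordK ?ltn_mod // -cyc_mod modnDml cyc_mod.
Qed.

Lemma shift_shift k l w : k + l = n -> shift k (shift l w) = w.
Proof.
move=> kl; apply: eq_from_tnth => i.
by rewrite tnth_mktuple cyc_shift -addnA kl cycDn cyc_small.
Qed.

Lemma all_letters_shift k w : all_letters w -> all_letters (shift k w).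
Proof.
move=> /all_lettersP rw; apply/all_lettersP; split; first exact: cycDn.
move=> a; have [j _ e] := recurrent_after (ltn0Sn m) rw k a.
by exists j; rewrite cyc_shift addnC.
Qed.

Lemma switches_shift k w a b : all_letters w ->
  switches n (cyc (shift k w)) a b = switches n (cyc w) a b.
Proof.
move=> /all_lettersP rw; pose G t : nat := switch_at n (cyc w) a b t.
have GDn t : G (t + n) = G t by rewrite /G (switch_atDn (ltn0Sn m) rw).
rewrite [RHS](_ : _ = \sum_(t < n) G t) // -(sum_periodic_shift (ltn0Sn m) k GDn).
by apply: eq_bigr => t _; rewrite (switch_at_shift _ _ _ (cyc_shift k w)).
Qed.

(** [p] is an ordering of the exceptional pair. The reversed pair is special too, by symmetry of
    [switches]. *)
Definition special w p :=
  [&& all_letters w, p.1 != p.2, switches n (cyc w) p.1 p.2 == 2 &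
    [forall q : T * T, [&& q.1 != q.2, q != p & q != (p.2, p.1)] ==>
      (switches n (cyc w) q.1 q.2 == 1)]].

Lemma special_shift k w p : special w p -> special (shift k w) p.
Proof.
case/and4P=> aw np s2 /forallP s1; rewrite /special all_letters_shift // np.
rewrite switches_shift // s2; apply/forallP => q; rewrite switches_shift //.
Qed.

Definition special_at t p :=
  [set w : n.-tuple T | special w p && switch_at n (cyc w) p.1 p.2 t].

Lemma card_special_at p (t : 'I_n) : #|special_at t p| = #|special_at m p|.
Proof.
have tm : t <= m by rewrite -ltnS.
(* Rotation by [t.+1] brings time [t] to the last position [m], since [m + t.+1 = t + n]; rotation
   by [m - t] undoes it. *)
apply: (@card_bij _ _ _ _ (shift t.+1) (shift (m - t))) => w; rewrite !inE => /andP[sw aw].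
  rewrite special_shift // (switch_at_shift _ _ _ (cyc_shift _ w)).
  rewrite addnS -addSn addnC switch_atDn ?aw ?shift_shift //; first by lia.
  by case/and4P: sw => /all_lettersP.
rewrite special_shift // (switch_at_shift _ _ _ (cyc_shift _ w)) subnKC //.
by rewrite aw shift_shift // addSn subnKC.
Qed.

Lemma card_distinct : #|[set p : T * T | p.1 != p.2]| = #|T| * #|T|.-1.
Proof.
have := cardsC [set p : T * T | p.1 != p.2]; rewrite card_prod.
have -> : ~: [set p : T * T | p.1 != p.2] = [set (x, x) | x : T].
  apply/setP => -[x y]; rewrite !inE negbK /=; apply/eqP/imsetP => [->|[z _ [-> ->]] //].
  by exists y.
rewrite card_imset; last by move=> x y [].

by case: #|T| => [|k] /=; lia.
Qed.

(** Every ordered pair of distinct letters switches at least once. An excess of 2 in the total is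
    shared equally by a pair and its reverse, so it sits on one unordered pair, which has two
    orderings. *)
Lemma card_special w :
  #|[set p | special w p]| =
  2 * (all_letters w && (total_switches w == #|T| * #|T|.-1 + 2)).
Proof.
have [aw|naw] := boolP (all_letters w); last first.
  by apply: eq_card0 => p; rewrite !inE /special (negPf naw).
have rw := elimT (all_lettersP w) aw.
pose D := [set p : T * T | p.1 != p.2].
pose sw (p : T * T) := switches n (cyc w) p.1 p.2.
pose sg (p : T * T) := (p.2, p.1).
have sw_sg p : sw (sg p) = sw p by apply: switches_sym.
have swE p : p \in D -> sw p = 1 + (sw p).-1.
  by rewrite inE => /(switches_gt0 (ltn0Sn m) rw); rewrite /sw; case: switches.
have tot : total_switches w = #|T| * #|T|.-1 + \sum_(p in D) (sw p).-1.
  rewrite -card_distinct -/D -sum1_card -big_split /= -(eq_bigr _ swE).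
  rewrite /total_switches pair_big /= (bigID (mem D)) /= [X in _ + X]big1 ?addn0 //.
  by move=> p; rewrite inE negbK => /eqP e; rewrite e switches_eq0.
have sgN p : p \in D -> sg p != p.
  by case: p => x y; rewrite inE /sg xpair_eqE /= => nxy; rewrite [y == x]eq_sym (negPf nxy).
have sgD p : p \in D -> sg p \in D by rewrite !inE eq_sym.
have sum2 p : p \in D -> \sum_(q in D) (sw q).-1 =
    (sw p).-1 + (sw p).-1 + \sum_(q in D | (q != p) && (q != sg p)) (sw q).-1.
  move=> pD; rewrite (bigD1 p) //= (bigD1 (sg p)) /=; last by rewrite sgD // sgN.
  by rewrite sw_sg addnA; congr (_ + _); apply: eq_bigl => q; rewrite andbA.
have specE p : special w p =
    (p \in D) && ((sw p).-1 == 1) && (\sum_(q in D | (q != p) && (q != sg p)) (sw q).-1 == 0).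
  rewrite /special aw inE /=; case: eqVneq => //= np.
  have := swE p; rewrite inE => /(_ np); rewrite -/(sw p) => ->.
  rewrite eqSS; congr (_ && _); rewrite sum_nat_eq0.
  apply: eq_forallb => q; rewrite inE; case: eqVneq => //= nq.
  have := swE q; rewrite inE => /(_ nq); rewrite -/(sw q) -/(sg p) => ->.
  by case: (_ && _); rewrite //= eqSS.
rewrite tot eqn_add2l /=; have [s2|ns2] := eqVneq (\sum_(q in D) (sw q).-1) 2; last first.
  apply: eq_card0 => p; rewrite inE specE; apply: contraNF ns2.
  by case/andP=> /andP[pD /eqP s1] /eqP s0; rewrite (sum2 p) // s1 s0.
have [p pD sp] : exists2 p, p \in D & 0 < (sw p).-1.
  apply/exists_inP; apply: contraT; rewrite negb_exists_in => /forall_inP z.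
  by move: s2; rewrite big1 // => p /z; rewrite -eqn0Ngt => /eqP.
have := sum2 p pD; rewrite s2 => e.
(* [e] writes 2 as twice the positive excess of [p] plus the excess of the other pairs. *)
have s1 : (sw p).-1 = 1 by lia.
have s0 : \sum_(q in D | (q != p) && (q != sg p)) (sw q).-1 = 0 by lia.
rewrite -[RHS](_ : #|[set p; sg p]| = _); last by rewrite cards2 eq_sym sgN.
apply: eq_card => q; rewrite !inE specE; apply/idP/orP => [/andP[/andP[qD /eqP q1] _]|].
  move/eqP: s0; rewrite sum_nat_eq0 => /forall_inP /(_ q); rewrite qD q1 /=.
  by case: eqP => [|_]; [left|case: eqP => [|_ /(_ isT)//]; right].
case=> /eqP->; first by rewrite pD s1 s0.
rewrite sgD // sw_sg s1 /=; apply/eqP; rewrite -[RHS]s0; apply: eq_bigl => r.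
by rewrite [sg (sg p)](_ : _ = p) 1?[(_ != sg p) && _]andbC //; case: (p).
Qed.

(** Double counting of words with an ordering of the exceptional pair and the time of one of its
    switches: each word has two orderings with two switches each, and by rotation all [n] times
    carry the same number of words. *)
Lemma card_special_words :
  4 * #|[set w : n.-tuple T | all_letters w && (total_switches w == #|T| * #|T|.-1 + 2)]| =
  n * \sum_(p : T * T | p.1 != p.2) #|special_at m p|.
Proof.
transitivity (\sum_(p : T * T | p.1 != p.2) \sum_(t < n) #|special_at t p|); last first.
  rewrite big_distrr /=; apply: eq_bigr => p _.
  under eq_bigr do rewrite card_special_at.
  by rewrite sum_nat_const card_ord.
transitivity (\sum_(p : T * T | p.1 != p.2) \sum_(w | special w p) 2); last first.
  apply: eq_bigr => p _; under [RHS]eq_bigr do rewrite -sum1_card.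
  transitivity (\sum_(w | special w p) switches n (cyc w) p.1 p.2).
    by apply: eq_bigr => w /and4P[_ _ /eqP-> _].
  rewrite /switches exchange_big /=; apply: eq_bigr => t _.
  rewrite -big_mkcondr; apply: eq_bigl => w.
  by rewrite inE.
rewrite (exchange_big_dep xpredT) //=.
transitivity (\sum_w (2 * #|[set p | special w p]|)).
  rewrite -[X in 4 * X = _]sum1_card big_mkcond big_distrr /=; apply: eq_bigr => w _.
  by rewrite card_special inE; case: (_ && _).
apply: eq_bigr => w _; rewrite sum_nat_const mulnC; congr (_ * _).
apply: eq_card => p; rewrite !inE unfold_in /=.
by apply/idP/andP => [h|[]//]; split=> //; case/and4P: h.
Qed.

End Rotation.

(** * Words ending with a switch of the exceptional pair *)

Section Windows.

Variables (T : eqType) (u : nat -> T).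

Definition window i j := [seq u t | t <- index_iota i j].

Lemma window_nil i : window i i = [::].
Proof. by rewrite /window /index_iota subnn. Qed.

Lemma window_cons i j : i < j -> window i j = u i :: window i.+1 j.
Proof. by move=> ij; rewrite /window /index_iota -(subnSK ij). Qed.

Lemma window_cat i j k : i <= j <= k -> window i k = window i j ++ window j k.
Proof.
move=> /andP[ij jk]; rewrite /window /index_iota.
have -> : k - i = (j - i) + (k - j) by lia.
by rewrite iotaD subnKC // map_cat.
Qed.

Lemma window_rcons i j : i <= j -> window i j.+1 = rcons (window i j) (u j).
Proof.
move=> ij; rewrite (@window_cat i j) ?ij ?leqnSn // (@window_cons j) // window_nil.
by rewrite cats1.
Qed.

Lemma subseq_windowP a s i j :
  subseq (a :: s) (window i j) <->
  exists t, [/\ i <= t < j, u t = a & subseq s (window t.+1 j)].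
Proof.
split=> [|[t [/andP[it tj] <- h]]]; last first.
  rewrite (@window_cat i t) ?it ?(ltnW tj) // (window_cons tj).
  by apply: (@cat_subseq _ [::] (u t :: s)); rewrite ?sub0seq //= eqxx.
move: {2}(j - i) (erefl (j - i)) => k; elim: k i => [|k IH] i e.
  by rewrite /window /index_iota e.
have ij : i < j by rewrite -subn_gt0 e.
rewrite (window_cons ij) /=; case: eqP => [-> h|_ /IH[|t [/andP[it tj] ut h]]].
- by exists i; rewrite leqnn.
- by rewrite subnS e.
by exists t; rewrite tj ltnW.
Qed.

Lemma subseq_window3 a b c i j :
  subseq [:: a; b; c] (window i j) <->
  exists r s t, [/\ i <= r < s, s < t < j & [/\ u r = a, u s = b & u t = c]].
Proof.
split.
  case/subseq_windowP=> r [h1 ur /subseq_windowP[s [h2 us /subseq_windowP[t [h3 ut _]]]]].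
  by exists r, s, t; split=> //; lia.
case=> r [s [t [h1 h2 [ur us ut]]]].
apply/subseq_windowP; exists r; split=> //; first by lia.
apply/subseq_windowP; exists s; split=> //; first by lia.
by apply/subseq_windowP; exists t; rewrite sub0seq; split=> //; lia.
Qed.

Lemma subseq_window4 a b c d i j :
  subseq [:: a; b; c; d] (window i j) <->
  exists r s t k, [/\ i <= r < s, s < t < k, k < j
    & [/\ u r = a, u s = b, u t = c & u k = d]].
Proof.
split.
  case/subseq_windowP=> r [h1 ur /subseq_window3[s [t [k [h2 h3 [us ut uk]]]]]].
  by exists r, s, t, k; split=> //; lia.
case=> r [s [t [k [h1 h2 h3 [ur us ut uk]]]]].
apply/subseq_windowP; exists r; split=> //; first by lia.
by apply/subseq_window3; exists s, t, k; split=> //; lia.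
Qed.

End Windows.

(** * Runs of the exceptional pair *)

Section Alternating.

Variables (T : eqType) (x y : T).
Hypothesis nxy : x != y.

(** The last letter is always [x]; [alternating 4] is the initial stack [[:: y; x; y; x]]. *)
Fixpoint alternating q := if q is q'.+1 then (if odd q' then y else x) :: alternating q' else [::].

Lemma size_alternating q : size (alternating q) = q.
Proof. by elim: q => //= q ->. Qed.

Lemma cons_new_alternating_x q : 0 < q ->
  cons_new x (alternating q) = alternating (if odd q then q else q.+1).
Proof.
case: q => // q _; rewrite /cons_new /=; case oq: (odd q) => /=.
  by rewrite oq -[Some y == _]/(y == x) eq_sym (negPf nxy).
by rewrite eqxx oq.
Qed.

Lemma cons_new_alternating_y q : 0 < q ->
  cons_new y (alternating q) = alternating (if odd q then q.+1 else q).
Proof.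
case: q => // q _; rewrite /cons_new /=; case oq: (odd q) => /=.
  by rewrite eqxx oq.
by rewrite oq -[Some x == _]/(x == y) (negPf nxy).
Qed.

End Alternating.

Section RootPair.

Variables (T : finType) (n : nat) (u : nat -> T) (x y : T).
Hypotheses (n_gt0 : 0 < n) (u_rec : recurrent n u) (nxy : x != y).
Hypotheses (u_last : u n.-1 = x) (y_first : wait n u 0 y < wait n u 0 x).

Let roots t := destutter (filter (pred2 x y) (window u t n)).

Lemma roots_alternating k : k < n -> exists q,
  [/\ 0 < q, roots (n.-1 - k) = alternating x y q,
      (wait n u (n.-1 - k) y < wait n u (n.-1 - k) x) = ~~ odd q &
      \sum_(n.-1 - k <= s < n) switch_at n u x y s = uphalf q].
Proof.
elim: k => [|k IH] kn.
  exists 1; rewrite subn0 /roots window_cons ?prednK // window_nil big_ltn ?prednK //.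
  rewrite big_geq // addn0 /= u_last eqxx /= -[X in wait n u X x]/(n.-1).
  split=> //; first by rewrite -[in wait n u _ x]u_last wait_cur.
  rewrite /switch_at u_last eqxx prednK // -[n]add0n !waitDn //.
  by rewrite y_first.
have [q [q0 e1 e2 e3]] := IH (ltnW kn).
set t := n.-1 - k.+1; have tS : n.-1 - k = t.+1 by lia.
have tn : t < n by lia.
rewrite tS in e1 e2 e3; rewrite /roots window_cons // big_ltn // e3.
have [ux|nx] := eqVneq (u t) x.
  exists (if odd q then q else q.+1).
  rewrite /= ux eqxx /= -/(roots t.+1) e1 cons_new_alternating_x //.
  rewrite -[in wait n u t x]ux wait_cur // /switch_at ux eqxx e2.
  by case: ifP => oq; rewrite /= ?oq; split=> //; rewrite ?uphalf_half ?oq //.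
have sw0 : switch_at n u x y t = false by rewrite /switch_at (negPf nx).
rewrite sw0 add0n; have [uy|ny] := eqVneq (u t) y.
  exists (if odd q then q.+1 else q).
  rewrite /= uy eqxx orbT /= -/(roots t.+1) e1 cons_new_alternating_y //.
  rewrite -[in wait n u t y]uy wait_cur // (waitS n_gt0 u_rec nx).
  by case: ifP => oq; rewrite /= ?oq; split=> //; rewrite ?uphalf_half ?oq //.
exists q; rewrite /= (negPf nx) (negPf ny) /=.
by rewrite (waitS n_gt0 u_rec nx) (waitS n_gt0 u_rec ny) ltnS.
Qed.

Lemma switches_eq2 :
  (switches n u x y == 2) = (destutter (filter (pred2 x y) (window u 0 n)) == [:: y; x; y; x]).
Proof.
have [|q [q0 e1 e2 e3]] := @roots_alternating n.-1; first by rewrite prednK.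
rewrite subnn in e1 e2 e3; rewrite -/(roots 0) e1 /switches.
rewrite -(big_mkord xpredT (fun t => switch_at n u x y t : nat)) e3.
apply/eqP/eqP => [h|/(congr1 size)]; last by rewrite size_alternating => ->.
(* Two switches leave 3 and 4 for [q], and [q] is even because [y] comes first. *)
suff -> : q = 4 by [].
by move: e2; rewrite y_first; move: h; rewrite uphalf_half; lia.
Qed.

End RootPair.

Section SpecialWords.

Variables (T : finType) (m : nat) (x y : T).
Local Notation n := m.+1.
Hypothesis nxy : x != y.

Lemma val_window (w : n.-tuple T) : val w = window (cyc w) 0 n.
Proof.
apply: (@eq_from_nth _ x) => [|i]; rewrite size_tuple; first by rewrite size_map size_iota.
move=> lt; rewrite (nth_map 0) ?size_iota // nth_iota // add0n.
by rewrite -(tnth_nth x w (Ordinal lt)) -cyc_small.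
Qed.

Lemma index_ohead_filter s :
  ohead (filter (pred2 x y) s) = Some y -> index y s < index x s.
Proof.
elim: s => //= a s IH; case: (eqVneq a x) => [->|nx] /=.
  by case=> e; move: nxy; rewrite e eqxx.
by case: (eqVneq a y) => //= _ /IH.
Qed.

Lemma proper_stack_roots : proper_stack [:: y; x; y; x] (~: [set x; y]).
Proof.
have nyx : y != x by rewrite eq_sym.
have sE (a c : T) : (Some a == Some c) = (a == c) by [].
rewrite /proper_stack /= /cons_new /= sE (negPf nxy) /= sE (negPf nyx) /= sE (negPf nxy).
by rewrite eqxx !inE !eqxx !orbT.
Qed.

(** Since only [x] and [y] switch twice with each other, no other pair alternates as z c z c around
    the cycle, which is the noncrossing condition. The runs of [x] and [y] form the initial stack,
    and the marked switch puts [x] at the end. *)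
Lemma special_switchE (w : n.-tuple T) :
  special w (x, y) && switch_at n (cyc w) x y m = accepts [:: y; x; y; x] (~: [set x; y]) w.
Proof.
set U := ~: _; set u := cyc w.
have ps : proper_stack [:: y; x; y; x] U := proper_stack_roots.
have fU s : filter [predC U] s = filter (pred2 x y) s.
  by apply: eq_filter => a /=; rewrite !inE negbK.
have last_w : ends_outside U w = (u m \notin U).
  rewrite val_window window_rcons //.
  by case: (window _ 0 m) => //= a s; rewrite /ends_outside /= last_rcons.
have inU z c : z \in U -> c \notin U -> z != c by move=> zU; apply: contraNneq => <-.
apply/andP/idP => [[/and4P[aw _ /= s2 /forallP s1] /andP[/eqP um wm]]|].
  have rw := elimT (all_lettersP w) aw.
  have y0 : wait n u 0 y < wait n u 0 x by rewrite -!(waitDn (ltn0Sn m) rw 0).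
  move: (s2); rewrite (switches_eq2 (ltn0Sn m) rw nxy um y0) -val_window => /eqP dw.
  have one z c : z \in U -> z != c -> switches n u z c <= 1.
    move=> zU nzc; have := s1 (z, c); rewrite /= nzc !xpair_eqE.
    move: zU; rewrite !inE negb_or => /andP[/negPf-> /negPf->] /=.
    by move=> /eqP ->.
  apply: (noncrossing_accepts ps); split.
  - by rewrite fU.
  - by rewrite last_w um !inE eqxx.
  - by move=> z _; apply: (forallP aw z).
  - move=> z c zU cU; rewrite val_window -/u; apply/negP.
    case/subseq_window3=> i [j [k [ij jk [ui uj uk]]]].
    have nzc := inU _ _ zU cU.
    have km : k < m.
      rewrite ltn_neqAle -ltnS; apply/andP; split; last by case/andP: jk.
      apply: contraTneq zU => e; rewrite -uk e um.
      by rewrite !inE eqxx.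
    have four i1 j1 k1 l1 : i1 < j1 < k1 -> k1 < l1 < i1 + n ->
        u i1 = z -> u j1 = c -> u k1 = z -> u l1 = c -> False.
      move=> h1 h2 e1 e2 e3 e4; have := one _ _ zU nzc.
      by rewrite leqNgt (switches_gt1 (ltn0Sn m) rw nzc h1 h2 e1 e2 e3 e4).
    have four' i1 j1 k1 l1 : i1 < j1 < k1 -> k1 < l1 < i1 + n ->
        u i1 = c -> u j1 = z -> u k1 = c -> u l1 = z -> False.
      move=> h1 h2 e1 e2 e3 e4; have := one _ _ zU nzc.
      by rewrite leqNgt switches_sym // (switches_gt1 (ltn0Sn m) rw _ h1 h2 e1 e2 e3 e4) // eq_sym.
    have nzx : z != x by apply: inU => //; rewrite !inE eqxx.
    (* For [c = x] the final [x] at time [m] completes z x z x. *)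
    have [cx|ncx] := eqVneq c x.
      by apply: (four i j k m); rewrite ?um //; clear - ij jk km; lia.
    have cy : c = y by move: cU; rewrite !inE (negPf ncx) negbK => /eqP.
    have : subseq [:: y; x; y; x] (window u 0 n).
      rewrite -val_window -dw; apply: subseq_trans (destutter_subseq _) _.
      exact: filter_subseq.
    case/subseq_window4=> i1 [i2 [i3 [i4 [h1 h2 h3 [e1 e2 e3 e4]]]]].
    have neq r s (a b : T) : u r = a -> u s = b -> a != b -> r != s.
      by move=> <- <-; apply: contraNneq => ->.
    rewrite cy in uj four four' nzc.
    have d1 := neq _ _ _ _ ui e1 nzc; have d2 := neq _ _ _ _ uk e2 nzx.
    have d3 := neq _ _ _ _ uk e3 nzc.
    (* For [c = y], compare z y z at [i], [j], [k] with y x y x at [i1] to [i4]. If [i1 < i] there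
       is y z y z; otherwise, if [i2 < k], there is z x z x ending at [m]; otherwise [i3] completes
       z y z y. *)
    have [lt|ge] := ltnP i1 i.
      by apply: (four' i1 i j k) => //; clear - ij jk lt; lia.
    have [lt|ge2] := ltnP i2 k.
      have := one _ _ zU nzx.
      by rewrite leqNgt (@switches_gt1 _ _ _ (ltn0Sn m) rw _ _ i i2 k m) //;
        clear - h1 ij jk km ge d1 lt; lia.
    by apply: (four i j k i3) => //; clear - ij jk h2 h3 ge2 d2; lia.
  move=> z c zU cU nzc; rewrite val_window -/u; apply/negP.
  case/subseq_window4=> i [j [k [l [h1 h2 h3 [ui uj uk ul]]]]].
  have := one _ _ zU nzc.
  by rewrite leqNgt (switches_gt1 (ltn0Sn m) rw nzc _ _ ui uj uk ul) //; clear - h1 h2 h3; lia.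
move=> /(accepts_noncrossing ps)[h1 h2 h3 h4 h5].
rewrite fU in h1.
have memw a : (a == x) || (a == y) -> a \in val w.
  move=> ha; have: a \in destutter (filter (pred2 x y) w).
    by rewrite h1 !inE; case/orP: ha => ->; rewrite ?orbT.
  by rewrite mem_destutter mem_filter => /andP[].
have aw : all_letters w.
  apply/forallP => a; have [/memw //|/norP[nx ny]] := boolP ((a == x) || (a == y)).
  by apply: h3; rewrite !inE (negPf nx) (negPf ny).
have rw := elimT (all_lettersP w) aw.
have um : u m = x.
  have := last_destutter y (filter (pred2 x y) w); rewrite h1 /= => ->.
  rewrite val_window window_rcons // filter_rcons -/u.
  by move: h2; rewrite last_w !inE negbK => ->; rewrite last_rcons.
have y0 : wait n u 0 y < wait n u 0 x.
  rewrite /wait -[map _ _]/(window u 0 n) -val_window; apply: index_ohead_filter.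
  by rewrite -ohead_destutter h1.
split; last first.
  rewrite /switch_at um eqxx /=; rewrite -!(waitDn (ltn0Sn m) rw 0) in y0.
  exact: y0.
rewrite /special aw nxy (switches_eq2 (ltn0Sn m) rw nxy um y0) -val_window h1 eqxx /=.
apply/forallP => -[a c]; apply/implyP => /= /and3P[nac ne1 ne2].
rewrite eqn_leq (switches_gt0 (ltn0Sn m) rw nac) andbT leqNgt.
(* Two switches put an alternating pattern in the word. The noncrossing clauses exclude it if one of
   its letters is in [U]; otherwise the pair is [(x, y)] or its reverse, against [ne1] and [ne2]. *)
apply/negP => /(switches_gt1_pattern (ltn0Sn m) rw)[a' [c' [i [j [k [l [hac ij kl [ui uj uk ul]]]]]]]].
have nac' : a' != c' by case/orP: hac => /andP[/eqP-> /eqP->] //; rewrite eq_sym.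
have sub : subseq [:: a'; c'; a'; c'] (val w).
  rewrite val_window; apply/subseq_window4; exists i, j, k, l.
  by split=> //; clear - ij kl; lia.
have [aU|naU] := boolP (a' \in U); have [cU|ncU] := boolP (c' \in U).
- by have := h5 _ _ aU cU nac'; rewrite sub.
- have := h4 _ _ aU ncU; rewrite (subseq_trans _ sub) //.
  exact: (prefix_subseq [:: a'; c'; a'] [:: c']).
- have := h4 _ _ cU naU; rewrite (subseq_trans _ sub) //.
  exact: subseq_cons.
move: naU ncU ne1 ne2 hac nac'; rewrite !inE !negbK !xpair_eqE.
move=> /orP[/eqP->|/eqP->] /orP[/eqP->|/eqP->]; rewrite ?eqxx //= => ne1 ne2.
  by case/orP=> /andP[/eqP e1 /eqP e2]; rewrite -e1 -e2 ?eqxx in ne1 ne2.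
by case/orP=> /andP[/eqP e1 /eqP e2]; rewrite -e1 -e2 ?eqxx in ne1 ne2.
Qed.

Lemma card_special_at_last :
  #|special_at m m (x, y)| = (#|T| - 2)`! * walks n (#|T| - 2) 4.
Proof.
rewrite -(_ : #|~: [set x; y]| = #|T| - 2); last by rewrite cardsCs setCK cards2 nxy.
rewrite -(card_accepts n proper_stack_roots) /special_at; apply: eq_card => w.
by rewrite !inE special_switchE.
Qed.

End SpecialWords.

(** * Assembling the count *)

Theorem theorem5p1 (b n : nat) (hb : 2 <= b) (hn : 1 <= n) :
  #|[set A : n.-tuple 'I_b |
      [&& uses_top_card A, pi_seq A == 1%g
        & crossings A == b * (b - 1) + 2]]|
  = 'C(n, b + 2) * 'C(n, b - 2).
Proof.
case: b hb => // b' hb; case: n hn => // m _.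
have := @card_words_cards b' m (b'.+1 * (b'.+1 - 1) + 2) hb.
have := card_special_words 'I_b'.+1 m.
rewrite card_ord -subn1; set W := #|_|; set S := \sum_(_ | _) _ => e1 e2.
have eS : S = b'.+1 * (b'.+1 - 1) * ((b'.+1 - 2)`! * walks m.+1 (b'.+1 - 2) 4).
  rewrite /S (eq_bigr (fun=> (b'.+1 - 2)`! * walks m.+1 (b'.+1 - 2) 4)); last first.
    by case=> x y /= nxy; rewrite card_special_at_last // card_ord.
  by rewrite sum_nat_const -cardsE card_distinct card_ord subn1.
have eF : b'.+1 * (b'.+1 - 1) * (b'.+1 - 2)`! = b'.+1`!.
  by case: (b') hb => // k _; rewrite !subSS !subn0 -mulnA -!factS.
(* Both sides are compared after multiplication by 4 and by the factorial of the number of balls: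
   the factorial counts the namings of the balls, and [walks_closed] supplies the 4 as the starting
   height. *)
apply/eqP; rewrite -(eqn_pmul2l (fact_gt0 b'.+1)) -e2 -(eqn_pmul2l (isT : 0 < 4)) e1 eS.
rewrite [X in m.+1 * X]mulnA eF mulnCA walks_closed.
by rewrite (_ : b'.+1 - 2 + 4 = b'.+1 + 2) ?[_ * 'C(_, b'.+1 + 2)]mulnC 1?mulnCA //; lia.
Qed.
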